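(* Let $(M,d)$ be a proper ultrametric space, pointed with origin $0$, and let $$S=\left\{ f\in lip_0(M)\ ;\ \lim_{r\rightarrow +\infty}\ \sup_{\substack{x \text{ or } y \notin \overline{B}(0,r)\\ x\neq y}}\frac{f(x)-f(y)}{d(x,y)}=0 \right\},$$ normed by the Lipschitz constant. Then $\mathcal{F}(M)$ is isometrically isomorphic to $S^*$ and $S$ is isomorphic (as a Banach space) to $c_0(\mathbb{N})$.
   Context: All spaces are real. A metric space is proper if every closed ball is compact. It is ultrametric if $d(x,z)\le\max\{d(x,y),d(y,z)\}$ for all points $x,y,z$. A pointed metric space $(M,d)$ is a metric space with a distinguished point (origin) $0\in M$. $\overline{B}(x,r)=\{y\in M: d(x,y)\le r\}$ is the closed ball. $Lip_0(M)$ is the Banach space of Lipschitz functions $f:M\to\mathbb{R}$ with $f(0)=0$, normed by the Lipschitz constant $\|f\|_L$. $lip_0(M)$ is the subspace of those $f\in Lip_0(M)$ such that for every $\varepsilon>0$ there is $\delta>0$ such that $d(x,y)<\delta$ implies $|f(x)-f(y)|\le\varepsilon d(x,y)$. For $x\in M$, $\delta_x\in Lip_0(M)^*$ is given by $\delta_x(f)=f(x)$; the Lipschitz-free space $\mathcal{F}(M)$ is the norm-closed linear span of $\{\delta_x: x\in M\}$ in $Lip_0(M)^*$. In the definition of $S$, the supremum is over pairs $(x,y)\in M^2$ with $x\ne y$ and at least one of $x,y$ outside $\overline{B}(0,r)$; the supremum over an empty set of pairs is taken to be $0$ (so $S=lip_0(M)$ if $M$ is bounded).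
   Formalization: The isomorphism of S with c_0(N) is stated only for infinite M: for finite M the space S has finite dimension |M|-1, so it is not isomorphic to c_0(N); the isometry of F(M) with S^* is stated for every M. *)

(* Defs.v *)
From HB Require Import structures.
From mathcomp Require Import all_boot all_order all_algebra.
From mathcomp Require Import all_classical all_reals all_analysis.

Set Implicit Arguments.
Unset Strict Implicit.
Unset Printing Implicit Defensive.

Import Order.TTheory GRing.Theory Num.Theory.
Import numFieldNormedType.Exports.

Local Open Scope classical_set_scope.
Local Open Scope ring_scope.

Section sup_lemmas.
Context {R : realType}.
Implicit Types A B : set R.

(* [sup set0 = 0], so a nonnegative upper bound suffices. *)
Lemma sup_le_nneg A (b : R) : 0 <= b -> ubound A b -> sup A <= b.
Proof.
move=> b0 Ab; have [->|/set0P A0] := eqVneq A set0; first by rewrite sup0.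
exact: ge_sup.
Qed.

Lemma sup_ge_nneg A : has_ubound A -> (forall x, A x -> 0 <= x) -> 0 <= sup A.
Proof.
move=> ubA A_ge0; have [->|/set0P[x Ax]] := eqVneq A set0; first by rewrite sup0.
exact: le_trans (A_ge0 _ Ax) (ub_le_sup ubA Ax).
Qed.

Lemma sup_norm_scale (I : Type) (D : set I) (u : I -> R) (a : R) :
  has_ubound [set `|u i| | i in D] ->
  sup [set `|a * u i| | i in D] = `|a| * sup [set `|u i| | i in D].
Proof.
move=> ubu; have [->|a0] := eqVneq a 0.
  rewrite normr0 mul0r; apply/eqP; rewrite eq_le; apply/andP; split.
    by apply: sup_le_nneg => // _ [i _ <-]; rewrite mul0r normr0.
  apply: sup_ge_nneg; last by move=> _ [i _ <-].
  by exists 0 => _ [i _ <-]; rewrite mul0r normr0.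
have uba : has_ubound [set `|a * u i| | i in D].
  case: ubu => k uk; exists (`|a| * k) => _ [i Di <-].
  by rewrite normrM ler_wpM2l//; apply: uk; exists i.
apply/eqP; rewrite eq_le; apply/andP; split.
  apply: sup_le_nneg => [|_ [i Di <-]].
    by rewrite mulr_ge0//; apply: sup_ge_nneg => // _ [i _ <-].
  by rewrite normrM ler_wpM2l//; apply: ub_le_sup => //; exists i.
rewrite mulrC -ler_pdivlMr ?normr_gt0//.
apply: sup_le_nneg => [|_ [i Di <-]].
  by rewrite divr_ge0//; apply: sup_ge_nneg => // _ [i _ <-].
rewrite ler_pdivlMr ?normr_gt0// mulrC -normrM.
by apply: ub_le_sup => //; exists i.
Qed.

Lemma sup_norm_add (I : Type) (D : set I) (u v : I -> R) :
  has_ubound [set `|u i| | i in D] -> has_ubound [set `|v i| | i in D] ->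
  sup [set `|u i + v i| | i in D] <=
    sup [set `|u i| | i in D] + sup [set `|v i| | i in D].
Proof.
move=> ubu ubv; apply: sup_le_nneg => [|_ [i Di <-]].
  by rewrite addr_ge0//; apply: sup_ge_nneg => // _ [i _ <-].
rewrite (le_trans (ler_normD _ _))// lerD//.
  by apply: ub_le_sup => //; exists i.
by apply: ub_le_sup => //; exists i.
Qed.

Lemma sup_norm_eq0 (I : Type) (D : set I) (u : I -> R) i :
  has_ubound [set `|u i| | i in D] ->
  sup [set `|u i| | i in D] = 0 -> D i -> u i = 0.
Proof.
move=> ubu su Di; apply/eqP; rewrite -normr_le0 -su.
by apply: ub_le_sup => //; exists i.
Qed.

End sup_lemmas.

Section metric_spaces.
Context {R : realType}.

(* The library's [closed_ball] is the closure of the open ball instead. *)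
Definition cball (M : metricType R) (x : M) (r : R) : set M :=
  [set y | mdist x y <= r].

Definition proper_metric (M : metricType R) :=
  forall (x : M) (r : R), compact (cball x r).

Definition ultrametric (M : metricType R) :=
  forall x y z : M, mdist x z <= Num.max (mdist x y) (mdist y z).

End metric_spaces.

Section isomorphisms.
Context {R : realType}.

Definition isometrically_isomorphic (V W : normedModType R) :=
  exists f : {linear V -> W}, bijective f /\ forall v, `|f v| = `|v|.

Definition isomorphic (V W : normedModType R) :=
  exists (f : {linear V -> W}) (g : {linear W -> V}),
    [/\ cancel f g, cancel g f, continuous f & continuous g].

End isomorphisms.

Definition subnormed (R : realType) (V : normedModType R)
  (P : submodClosed V) : Type := {v : V | v \in P}.

Section subnormed_instances.
Context {R : realType} {V : normedModType R} (P : submodClosed V).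

HB.instance Definition _ := SubChoice.on (subnormed P).
HB.instance Definition _ := [SubChoice_isSubLmodule of subnormed P by <:].

Let norm (v : subnormed P) : R := `|val v|.

Let normD v w : norm (v + w) <= norm v + norm w.
Proof. exact: ler_normD. Qed.

Let normZ (a : R) v : norm (a *: v) = `|a| * norm v.
Proof. exact: normrZ. Qed.

Let norm0 v : norm v = 0 -> v = 0.
Proof. by move=> /normr0_eq0 v0; apply: val_inj. Qed.

HB.instance Definition _ :=
  Lmodule_isNormed.Build R (subnormed P) normD normZ norm0.

End subnormed_instances.

Section dual.
Context {R : realType} (V : normedModType R).

Definition dual_pred : {pred V -> R^o} :=
  [pred phi : V -> R^o | `[< linear phi /\ continuous phi >] ].

Lemma dual_submod_closed : submod_closed dual_pred.
Proof.
split.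
  apply/asboolP; split; first by move=> a u v; rewrite /= scaler0 addr0.
  by move=> x; exact: cvg_cst.
move=> a f g /asboolP[lf cf] /asboolP[lg cg]; apply/asboolP; split.
  by move=> b u v; rewrite !fctE lf lg !scalerDr !scalerA (mulrC a b) addrACA.
move=> x; apply: (@cvgD _ _ _ (nbhs x)); last exact: cg.
by apply: cvgZr; exact: cf.
Qed.

HB.instance Definition _ :=
  GRing.isSubmodClosed.Build R (V -> R^o) dual_pred dual_submod_closed.

Definition dual : Type := {phi : V -> R^o | phi \in dual_pred}.

HB.instance Definition _ := SubChoice.on dual.
HB.instance Definition _ := [SubChoice_isSubLmodule of dual by <:].

Definition dual_fun (phi : dual) : V -> R^o := val phi.
Coercion dual_fun : dual >-> Funclass.

Lemma dual_funP (phi : dual) : linear phi /\ continuous (dual_fun phi).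
Proof. by apply/asboolP; exact: (valP phi). Qed.

HB.instance Definition _ (phi : dual) :=
  GRing.isLinear.Build R V R^o _ phi (dual_funP phi).1.

Lemma dual_continuous (phi : dual) : continuous phi.
Proof. by have [] := dual_funP phi. Qed.

Definition dual_norm (phi : dual) : R :=
  sup [set `|phi v| | v in [set v : V | `|v| <= 1]].

Lemma dual_bounded (phi : dual) :
  has_ubound [set `|phi v| | v in [set v : V | `|v| <= 1]].
Proof.
have : bounded_near phi (nbhs (0 : V)).
  by apply/linear_bounded_continuous; exact: dual_continuous.
by move=> /bounded_funP/(_ 1)[k fk]; exists k => _ [v /= v1 <-]; exact: fk.
Qed.

Let dual_normD phi psi : dual_norm (phi + psi) <= dual_norm phi + dual_norm psi.
Proof.
exact: (sup_norm_add (dual_bounded phi) (dual_bounded psi)).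
Qed.

Let dual_normZ (a : R) phi : dual_norm (a *: phi) = `|a| * dual_norm phi.
Proof. exact: (sup_norm_scale a (dual_bounded phi)). Qed.

Let dual_norm0 phi : dual_norm phi = 0 -> phi = 0.
Proof.
move=> phi0; apply: val_inj; apply/funext => v; rewrite -[val phi v]/(phi v)/=.
have [->|v0] := eqVneq v 0; first exact: linear0.
have nv : `|v| != 0 by rewrite normr_eq0.
have : phi (`|v|^-1 *: v) = 0.
  apply: (sup_norm_eq0 (dual_bounded phi) phi0) => /=.
  by rewrite normrZ normfV normr_id mulVf.
rewrite linearZ/= => /eqP; rewrite scaler_eq0 invr_eq0 (negbTE nv)/=.
by move=> /eqP.
Qed.

HB.instance Definition _ :=
  Lmodule_isNormed.Build R dual dual_normD dual_normZ dual_norm0.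

End dual.

Section closed_span.
Context {R : realType} {V : normedModType R}.

Definition linear_span (A : set V) : set V :=
  [set v | exists (n : nat) (c : 'I_n -> R) (a : 'I_n -> V),
     (forall i, A (a i)) /\ v = \sum_i c i *: a i].

Definition closed_span (A : set V) : {pred V} :=
  [pred v | v \in closure (linear_span A)].

Lemma linear_spanP (A : set V) (k : R) u v :
  linear_span A u -> linear_span A v -> linear_span A (k *: u + v).
Proof.
move=> [n [c [a [Aa ->]]]] [m [d [b [Ab ->]]]].
exists (n + m)%N.
exists (fun i => match fintype.split i with inl j => k * c j | inr j => d j end).
exists (fun i => match fintype.split i with inl j => a j | inr j => b j end).
split; first by move=> i; case: fintype.split.
rewrite big_split_ord/= scaler_sumr; congr (_ + _); apply: eq_bigr => i _.
  by case: split_ordP => j; [move/lshift_inj => <-; rewrite scalerA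
    | move/eqP; rewrite eq_lrshift].
by case: split_ordP => j; [move/eqP; rewrite eq_rlshift | move/rshift_inj => <-].
Qed.

Lemma closed_span_submod_closed (A : set V) : submod_closed (closed_span A).
Proof.
split.
  rewrite inE; apply: subset_closure; exists 0%N, (fun=> 0), (fun=> 0).
  by split; [case | rewrite big_ord0].
move=> k u v; rewrite !inE => /= clu clv B kuvB.
have : \forall x \near u & y \near v, B (k *: x + y).
  have : (fun z : V * V => k *: z.1 + z.2) @ (u, v) --> k *: u + v.
    apply: (@cvgD _ _ _ (nbhs (u, v))); last exact: cvg_snd.
    by apply: cvgZr; exact: cvg_fst.
  by move=> /(_ _ kuvB).
move=> [[U W]] /= [uU vW] UWB.
have [x [Ax Ux]] := clu _ uU; have [y [Ay Wy]] := clv _ vW.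
exists (k *: x + y); split; first exact: linear_spanP.
exact: (UWB (x, y)).
Qed.

HB.instance Definition _ (A : set V) :=
  GRing.isSubmodClosed.Build R V (closed_span A) (closed_span_submod_closed A).

End closed_span.

Section Lip0.
Context {R : realType} {M : metricType R} (o : M).

(* The library's [lipschitz] requires a normed domain. *)
Definition Lip0_pred : {pred M -> R^o} :=
  [pred f : M -> R^o | `[< f o = 0 /\
    exists k : R, forall x y, `|f x - f y| <= k * mdist x y >] ].

Lemma Lip0_submod_closed : submod_closed Lip0_pred.
Proof.
split.
  apply/asboolP; split=> //; exists 0 => x y.
  by rewrite subrr normr0 mul0r.
move=> a f g /asboolP[fo [k fk]] /asboolP[go [l gl]]; apply/asboolP; split.
  by rewrite !fctE fo go scaler0 addr0.
exists (`|a| * k + l) => x y; rewrite !fctE opprD addrACA -scalerBr.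
rewrite (le_trans (ler_normD _ _))// mulrDl lerD// normrZ -mulrA.
by rewrite ler_wpM2l.
Qed.

HB.instance Definition _ :=
  GRing.isSubmodClosed.Build R (M -> R^o) Lip0_pred Lip0_submod_closed.

Definition Lip0 : Type := {f : M -> R^o | f \in Lip0_pred}.

HB.instance Definition _ := SubChoice.on Lip0.
HB.instance Definition _ := [SubChoice_isSubLmodule of Lip0 by <:].

Definition Lip0_fun (f : Lip0) : M -> R^o := val f.
Coercion Lip0_fun : Lip0 >-> Funclass.

Lemma Lip0_funD (f g : Lip0) x : (f + g : Lip0) x = f x + g x.
Proof. by []. Qed.

Lemma Lip0_funZ (a : R) (f : Lip0) x : (a *: f : Lip0) x = a * f x.
Proof. by []. Qed.

Definition slope (f : M -> R) (p : M * M) : R :=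
  (f p.1 - f p.2) / mdist p.1 p.2.

Definition Lip0_norm (f : Lip0) : R :=
  sup [set `|slope f p| | p in [set p | p.1 != p.2]].

Lemma Lip0P (f : Lip0) : f o = 0 /\
  exists k : R, forall x y, `|f x - f y| <= k * mdist x y.
Proof. by apply/asboolP; exact: (valP f). Qed.

Lemma slope_bounded (f : Lip0) :
  has_ubound [set `|slope f p| | p in [set p | p.1 != p.2]].
Proof.
have [_ [k fk]] := Lip0P f; exists k => _ [[x y] /= xy <-].
rewrite /slope/= normrM normfV (ger0_norm (mdist_ge0 _ _)).
by rewrite ler_pdivrMr ?mdist_gt0.
Qed.

Lemma slopeD (f g : Lip0) p :
  slope (f + g : Lip0) p = slope f p + slope g p.
Proof. by rewrite /slope !Lip0_funD opprD addrACA mulrDl. Qed.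

Lemma slopeZ a (f : Lip0) p : slope (a *: f : Lip0) p = a * slope f p.
Proof. by rewrite /slope !Lip0_funZ -mulrBr -mulrA. Qed.

Let Lip0_normD f g : Lip0_norm (f + g) <= Lip0_norm f + Lip0_norm g.
Proof.
apply: le_trans (sup_norm_add (slope_bounded f) (slope_bounded g)).
by rewrite /Lip0_norm; under eq_imagel do rewrite slopeD.
Qed.

Let Lip0_normZ (a : R) f : Lip0_norm (a *: f) = `|a| * Lip0_norm f.
Proof.
rewrite -(sup_norm_scale a (slope_bounded f)) /Lip0_norm.
by under eq_imagel do rewrite slopeZ.
Qed.

Let Lip0_norm0 f : Lip0_norm f = 0 -> f = 0.
Proof.
move=> f0; apply: val_inj; apply/funext => x /=.
have [fo _] := Lip0P f; have [->//|xo] := eqVneq x o.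
have /eqP : slope f (x, o) = 0.
  exact: (sup_norm_eq0 (slope_bounded f) f0).
rewrite mulf_eq0 invr_eq0/= fo subr0 => /orP[/eqP//|/eqP/mdist_positivity xo'].
by rewrite xo' eqxx in xo.
Qed.

HB.instance Definition _ :=
  Lmodule_isNormed.Build R Lip0 Lip0_normD Lip0_normZ Lip0_norm0.

Lemma Lip0_normE (f : Lip0) :
  `|f| = sup [set `|slope f p| | p in [set p | p.1 != p.2]].
Proof. by []. Qed.

Lemma slope_le (f : Lip0) p : `|slope f p| <= `|f|.
Proof.
have [e|ne] := eqVneq p.1 p.2; first by rewrite /slope e subrr mul0r normr0.
by apply: ub_le_sup; [exact: slope_bounded | exists p].
Qed.

Lemma Lip0_le (f : Lip0) x y : `|f x - f y| <= `|f| * mdist x y.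
Proof.
have [->|xy] := eqVneq x y; first by rewrite subrr normr0 mulr_ge0 ?mdist_ge0.
rewrite -ler_pdivrMr ?mdist_gt0//.
have := slope_le f (x, y).
by rewrite /slope/= normrM normfV (ger0_norm (mdist_ge0 _ _)).
Qed.

End Lip0.

Section lip_free.
Context {R : realType} {M : metricType R} (o : M).

Definition eval_at (x : M) : Lip0 o -> R^o := fun f => f x.

Lemma eval_at_linear x : linear (eval_at x).
Proof. by []. Qed.

HB.instance Definition _ x :=
  GRing.isLinear.Build R (Lip0 o) R^o _ (eval_at x) (@eval_at_linear x).

Lemma eval_at_dual x : eval_at x \in dual_pred (V := Lip0 o).
Proof.
apply/asboolP; split; first exact: eval_at_linear.
apply: bounded_linear_continuous.
apply/bounded_funP => r; exists (r * mdist x o) => f fr.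
have [fo _] := Lip0P f; have := Lip0_le f x o; rewrite fo subr0 => /le_trans.
by apply; rewrite ler_wpM2r ?mdist_ge0.
Qed.

Definition delta (x : M) : dual (Lip0 o) :=
  exist (fun phi => phi \in dual_pred (V := Lip0 o)) (eval_at x) (eval_at_dual x).

Definition lip_free : normedModType R := subnormed (closed_span (range delta)).

End lip_free.

Section lip0.
Context {R : realType} {M : metricType R} (o : M).

Definition lip0 : set (Lip0 o) :=
  [set f | forall e : R, 0 < e -> exists2 d : R, 0 < d &
     forall x y, mdist x y < d -> `|f x - f y| <= e * mdist x y].

Definition outer_pairs (r : R) : set (M * M) :=
  [set p | p.1 != p.2 /\ (~ cball o r p.1 \/ ~ cball o r p.2)].

(* [sup set0 = 0], so the limit is automatically [0] when [M] is bounded.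
   The difference quotients are signed, but [outer_pairs r] is symmetric, so
   this bounds their absolute values as well, see [outer_slopeP]. *)
Definition lip0_flat : {pred Lip0 o} :=
  [pred f | `[< lip0 f /\
    sup [set slope f p | p in outer_pairs r] @[r --> +oo] --> (0 : R) >] ].

Lemma outer_slopeP (f : Lip0 o) :
  sup [set slope f p | p in outer_pairs r] @[r --> +oo] --> (0 : R) <->
  forall e : R, 0 < e ->
    \forall r \near +oo, forall p, outer_pairs r p -> `|slope f p| <= e.
Proof.
have ub r : has_ubound [set slope f p | p in outer_pairs r].
  by exists `|f| => _ [p _ <-]; exact: le_trans (ler_norm _) (slope_le f p).
have sym r p : outer_pairs r p -> outer_pairs r (p.2, p.1).
  by move=> [np op]; split; [rewrite eq_sym | case: op; [right|left]].
have slopeN p : slope f (p.2, p.1) = - slope f p.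
  by rewrite /slope/= metric_sym -mulNr opprB.
split=> [/cvgrPdist_le fl e e0|fl].
  near=> r => p op; have : `|0 - sup [set slope f p | p in outer_pairs r]| <= e.
    by near: r; exact: fl.
  rewrite sub0r normrN => /(le_trans (ler_norm _)) se.
  rewrite ler_norml lerNl -slopeN; apply/andP; split; apply: le_trans se.
    by apply: ub_le_sup => //; exists (p.2, p.1) => //; exact: sym.
  by apply: ub_le_sup => //; exists p.
apply/cvgrPdist_le => e e0; near=> r; rewrite sub0r normrN.
have fr : forall p, outer_pairs r p -> `|slope f p| <= e.
  by near: r; exact: fl.
have [->|/set0P[p op]] := eqVneq (outer_pairs r) set0.
  by rewrite image_set0 sup0 normr0 ltW.
rewrite ger0_norm.
  apply: sup_le_nneg => [|_ [q oq <-]]; first exact: ltW.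
  exact: le_trans (ler_norm _) (fr _ oq).
have [s0|s0] := leP 0 (slope f p).
  by apply: le_trans s0 _; apply: ub_le_sup => //; exists p.
apply: (@le_trans _ _ (slope f (p.2, p.1))).
  by rewrite slopeN oppr_ge0 ltW.
by apply: ub_le_sup => //; exists (p.2, p.1) => //; exact: sym.
Unshelve. all: by end_near. Qed.

Lemma lip0_flat_submod_closed : submod_closed lip0_flat.
Proof.
split.
  apply/asboolP; split.
    move=> e e0; exists 1 => // x y _; rewrite subrr normr0.
    by rewrite mulr_ge0 ?mdist_ge0 ?ltW.
  apply/outer_slopeP => e e0; near=> r => p _.
  by rewrite /slope subrr mul0r normr0 ltW.
move=> a f g /asboolP[lf /outer_slopeP flf] /asboolP[lg /outer_slopeP flg].
have a1 : 0 < `|a| + 1 by rewrite ltr_wpDl.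
have split_eps (e s t : R) : s <= e / 2 / (`|a| + 1) -> t <= e / 2 ->
    0 <= s -> `|a| * s + t <= e.
  move=> se te s0; rewrite [leRHS]splitr lerD//.
  move: se; rewrite ler_pdivlMr// => /(le_trans _); apply.
  by rewrite mulrC ler_wpM2l// lerDl.
apply/asboolP; split.
  move=> e e0; have e1 : 0 < e / 2 / (`|a| + 1) by rewrite !divr_gt0.
  have e2 : 0 < e / 2 by rewrite divr_gt0.
  have [d d0 fd] := lf _ e1; have [d' d'0 gd] := lg _ e2.
  exists (Num.min d d'); first by rewrite lt_min d0.
  move=> x y; rewrite lt_min => /andP[xyd xyd'].
  rewrite !Lip0_funD !Lip0_funZ opprD addrACA -mulrBr.
  rewrite (le_trans (ler_normD _ _))// normrM.
  have [->|xy] := eqVneq x y.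
    by rewrite !subrr normr0 mulr0 addr0 mulr_ge0 ?mdist_ge0// ltW.
  have xy0 : 0 < mdist x y by rewrite mdist_gt0.
  rewrite -ler_pdivrMr// mulrDl -mulrA; apply: split_eps.
  - by rewrite ler_pdivrMr// fd.
  - by rewrite ler_pdivrMr// gd.
  - by rewrite divr_ge0 ?mdist_ge0.
apply/outer_slopeP => e e0.
have e1 : 0 < e / 2 / (`|a| + 1) by rewrite !divr_gt0.
have e2 : 0 < e / 2 by rewrite divr_gt0.
near=> r => p op; rewrite slopeD slopeZ (le_trans (ler_normD _ _))// normrM.
apply: split_eps => //; move: p op; near: r; [exact: flf|exact: flg].
Unshelve. all: by end_near. Qed.

HB.instance Definition _ :=
  GRing.isSubmodClosed.Build R (Lip0 o) lip0_flat lip0_flat_submod_closed.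

Definition lip0_flat_space : normedModType R := subnormed lip0_flat.

End lip0.

Section c0.
Context (R : realType).

Definition c0_pred : {pred nat -> R^o} :=
  [pred u : nat -> R^o | `[< u @ \oo --> (0 : R^o) >] ].

Lemma c0_submod_closed : submod_closed c0_pred.
Proof.
split; first by apply/asboolP; exact: cvg_cst.
move=> a u v /asboolP u0 /asboolP v0; apply/asboolP.
rewrite -[X in _ --> X](addr0 (0 : R^o)) -[X in _ --> X + _](scaler0 _ a).
by apply: cvgD => //; exact: cvgZr.
Qed.

HB.instance Definition _ :=
  GRing.isSubmodClosed.Build R (nat -> R^o) c0_pred c0_submod_closed.

Definition c0 : Type := {u : nat -> R^o | u \in c0_pred}.

HB.instance Definition _ := SubChoice.on c0.
HB.instance Definition _ := [SubChoice_isSubLmodule of c0 by <:].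

Definition c0_fun (u : c0) : nat -> R^o := val u.
Coercion c0_fun : c0 >-> Funclass.

Definition c0_norm (u : c0) : R := sup [set `|u n| | n in [set: nat]].

Lemma c0_bounded (u : c0) : has_ubound [set `|u n| | n in [set: nat]].
Proof.
have /asboolP u0 := valP u.
have /cvg_seq_bounded[k [_ /(_ (k + 1)) uk]] : cvgn (val u).
  by apply/cvg_ex; exists 0.
by exists (k + 1) => _ [n _ <-]; apply: uk => //; rewrite ltrDl.
Qed.

Let c0_normD u v : c0_norm (u + v) <= c0_norm u + c0_norm v.
Proof. exact: (sup_norm_add (c0_bounded u) (c0_bounded v)). Qed.

Let c0_normZ (a : R) u : c0_norm (a *: u) = `|a| * c0_norm u.
Proof. exact: (sup_norm_scale a (c0_bounded u)). Qed.

Let c0_norm0 u : c0_norm u = 0 -> u = 0.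
Proof.
move=> u0; apply: val_inj; apply/funext => n.
exact: (sup_norm_eq0 (c0_bounded u) u0).
Qed.

HB.instance Definition _ :=
  Lmodule_isNormed.Build R c0 c0_normD c0_normZ c0_norm0.

End c0.

(* Main.v *)
Require Import Defs.
From HB Require Import structures.
From mathcomp Require Import all_boot all_order all_algebra.
From mathcomp Require Import all_classical all_reals all_analysis.
From mathcomp Require Import ring lra.

(** The space [M] is treated as a countable tree of balls.  Fix a sequence
    [x 0], [x 1], ... which together with [o] is dense, and let the parent of
    [x n] be the point of [o, x 0, ..., x (n - 1)] nearest to it.  Writing
    [gap n] for the distance from [x n] to its parent, the function
    [spike n = gap n * 1_(B n)], with [B n] the open ball of radius [gap n]
    around [x n], plays the role of a Haar function.  Sending a point to its
    nearest point among [o, x 0, ..., x (n - 1)] is a retraction [retr n], and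
    since the metric is ultrametric, passing from [retr n] to [retr n.+1] only
    moves the points of [B n], all of them from the parent of [x n] to [x n].
    Hence [f (retr n y)] is the [n]-th partial sum of
    [sum_k coef f k * spike k y], where [coef f k] is the slope of [f] between
    [x k] and its parent, and every Lipschitz [f] vanishing at [o] is the
    pointwise sum of this series ([synth_coef]).

    Two estimates turn this expansion into an isomorphism with c_0.  The
    coefficients are bounded by the Lipschitz constant, and they tend to [0]
    when [f] is in [S], because the [x n] with a gap bounded below that lie in
    a given compact ball are separated, hence finitely many ([coef_cvg0]).
    Conversely, for bounded coefficients the series converges to a Lipschitz
    function ([synth_lip]): balls [B n] sharing a point have strictly
    decreasing radii.  A strict decrease does not bound the sum of the radii,
    so all of this is done with the distance rounded up to a power of two,
    which is again ultrametric: the radii then decrease geometrically.  The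
    rounding costs a factor two, which an isomorphism can afford.

    For the duality, the candidate isometry restricts a functional on the
    Lipschitz functions to [S].  It is isometric on the free space because [S]
    interpolates any [f] on any finite set without increasing the Lipschitz
    constant ([flat_interpolation]): composing [f] with the nearest-point
    retraction, this time for the metric itself, gives a locally constant
    function with bounded support.  It is onto because a functional [phi] on
    [S] has absolutely summable values on the spikes ([weight_summable], a
    c_0-type estimate), so that the series of the [phi (spike n)] times the
    elementary molecules [f |-> coef f n] converges in norm, and its sum
    restricts to [phi]. *)

Set Implicit Arguments.
Unset Strict Implicit.
Unset Printing Implicit Defensive.

Import Order.TTheory GRing.Theory Num.Theory.
Import numFieldNormedType.Exports.

Local Open Scope classical_set_scope.
Local Open Scope ring_scope.

(** * Rounding up to a power of two *)

Section dyadic.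
Context {R : realType}.
Implicit Types s t : R.

(** For [t > 0], the least power of two, of integer exponent, that is at least
    [t]. *)
Definition dyadic t : R :=
  if 0 < t then 2 `^ (Num.ceil (ln t / ln 2))%:~R else 0.

Let ln2_gt0 : 0 < ln 2 :> R. Proof. by rewrite ln_gt0 ?ltr1n. Qed.

Let powR2_log t : 0 < t -> 2 `^ (ln t / ln 2) = t.
Proof.
move=> t0; rewrite /powR ifF; last by apply/negbTE; rewrite pnatr_eq0.
by rewrite divfK ?lnK// gt_eqF.
Qed.

Let powR2S z : 2 `^ (1 + z) = 2 * 2 `^ z :> R.
Proof. by rewrite powRD ?powRr1// pnatr_eq0 implybT. Qed.

Lemma dyadic_ge0 t : 0 <= dyadic t.
Proof. by rewrite /dyadic; case: ifP => // _; exact: powR_ge0. Qed.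

Lemma dyadic0 : dyadic 0 = 0.
Proof. by rewrite /dyadic ltxx. Qed.

Lemma dyadic_ge t : t <= dyadic t.
Proof.
rewrite /dyadic; case: ltP => // t0.
by rewrite -[leLHS]powR2_log// ler_powR ?ler1n// ceil_ge.
Qed.

Lemma dyadic_le t : 0 <= t -> dyadic t <= 2 * t.
Proof.
rewrite /dyadic; case: ltP => [t0 _|_ t0]; last by rewrite mulr_ge0.
rewrite -[in leRHS](powR2_log t0) -powR2S ler_powR ?ler1n//.
have := ceilB1_lt (ln t / ln 2).
by rewrite intrD ltrBlDl => /ltW.
Qed.

Lemma le_dyadic : {homo dyadic : s t / s <= t}.
Proof.
move=> s t st; rewrite /dyadic.
case: (ltP 0 s) => [s0|_]; last exact: dyadic_ge0.
rewrite (lt_le_trans s0 st) ler_powR ?ler1n// ler_int le_ceil//.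
by rewrite ler_pM2r ?invr_gt0// ler_ln ?posrE// (lt_le_trans s0).
Qed.

(** The gain of the rounding: a strict inequality between rounded values is an
    inequality by a factor two, so strictly decreasing rounded values decrease
    geometrically. *)
Lemma lt_dyadic s t : dyadic s < dyadic t -> 2 * dyadic s <= dyadic t.
Proof.
rewrite {1 3}/dyadic; case: (ltP 0 s) => [s0|_ _]; last first.
  by rewrite mulr0 dyadic_ge0.
rewrite /dyadic; case: (ltP 0 t) => [t0|_]; last first.
  by rewrite ltNge powR_ge0.
set a := Num.ceil _; set b := Num.ceil _ => ab.
rewrite -powR2S ler_powR ?ler1n//.
rewrite -[1]/(1%:~R) -intrD ler_int addrC lezD1.
rewrite ltNge; apply: contraTN ab => ba.
by rewrite -leNgt ler_powR ?ler1n// ler_int.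
Qed.

End dyadic.

(** * Nearest points of a list *)

Section nearest_point.
Context {R : realType} {T : eqType} (rho : T -> T -> R).
Implicit Types (o x y z : T) (s : seq T).

(** Ties go to the earliest point of [o :: s].  In particular, for an
    ultrametric, a point farther from [o] than all of [s] has the same distance
    to all of [o :: s] and is sent to [o]. *)
Definition nearest o s x :=
  foldl (fun b a => if rho x a < rho x b then a else b) o s.

Lemma nearest_rcons o s a x : nearest o (rcons s a) x =
  if rho x a < rho x (nearest o s x) then a else nearest o s x.
Proof. by rewrite /nearest foldl_rcons. Qed.

Lemma nearest_mem o s x : nearest o s x \in o :: s.
Proof.
elim/last_ind: s => [|s a IH]; first by rewrite mem_seq1.
rewrite nearest_rcons -rcons_cons mem_rcons in_cons.
by case: ifP => _; rewrite ?eqxx// IH orbT.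
Qed.

Lemma nearest_le o s x a : a \in o :: s -> rho x (nearest o s x) <= rho x a.
Proof.
elim/last_ind: s => [|s b IH]; first by rewrite mem_seq1 => /eqP->.
rewrite nearest_rcons -rcons_cons mem_rcons in_cons.
case: (ltP (rho x b)) => xb /orP[/eqP->//|/IH//].
by move=> /(lt_le_trans xb)/ltW.
Qed.

Lemma eq_nearest o s x y : {in o :: s, rho x =1 rho y} ->
  nearest o s x = nearest o s y.
Proof.
elim/last_ind: s => // s a IH xy; rewrite !nearest_rcons IH; last first.
  by move=> b bs; apply: xy; rewrite -rcons_cons mem_rcons in_cons bs orbT.
by rewrite !xy// -rcons_cons mem_rcons ?mem_head// in_cons nearest_mem orbT.
Qed.

Lemma nearest_origin o s x : {in s, forall a, rho x o <= rho x a} ->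
  nearest o s x = o.
Proof.
elim/last_ind: s => // s a IH xo; rewrite nearest_rcons IH; last first.
  by move=> b bs; apply: xo; rewrite mem_rcons in_cons bs orbT.
by rewrite ltNge xo// mem_rcons mem_head.
Qed.

Context (rhoC : forall x y, rho x y = rho y x).
Context (rho_ultra : forall x y z, rho x z <= Num.max (rho x y) (rho y z)).

Lemma ultra_isosceles x y z : rho x y < rho x z -> rho y z = rho x z.
Proof.
move=> xyz; apply/eqP; rewrite eq_le; apply/andP; split.
  apply: le_trans (rho_ultra y x z) _.
  by rewrite ge_max lexx rhoC ltW.
have := rho_ultra x y z; rewrite le_max => /orP[/(lt_le_trans xyz)|//].
by rewrite ltxx.
Qed.

(** By the isosceles property [x] and [y] have the same distance to each point
    of [o :: s], so the same comparisons are made for both. *)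
Lemma nearest_local o s x y : rho x y < rho x (nearest o s x) ->
  nearest o s y = nearest o s x.
Proof.
move=> xy; apply: eq_nearest => a ao; apply: ultra_isosceles.
exact: lt_le_trans xy (nearest_le x ao).
Qed.

(** When [x] and [y] are closer to each other than one of them is to its
    nearest point, [nearest_local] identifies the two nearest points.
    Otherwise the three steps from [nearest x] to [x], to [y], to [nearest y]
    all have length at most [rho x y]. *)
Lemma nearest_nonexpansive o s x y : nearest o s x <> nearest o s y ->
  rho (nearest o s x) (nearest o s y) <= rho x y.
Proof.
move=> xy.
have [/nearest_local/esym//|xx] := ltP (rho x y) (rho x (nearest o s x)).
have [|yy] := ltP (rho x y) (rho y (nearest o s y)).
  by rewrite rhoC => /nearest_local.
apply: le_trans (rho_ultra _ x _) _; rewrite ge_max rhoC xx/=.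
by apply: le_trans (rho_ultra _ y _) _; rewrite ge_max lexx yy.
Qed.

End nearest_point.

(** * The ball system of a sequence of points *)

(** After a nonzero first term [t 0] all later terms are at most [t 0 / 2], so
    by induction they add up to at most [t 0]. *)
Lemma halving_sum_le (R : realFieldType) (t : nat -> R) (r : R) :
  (forall n, 0 <= t n) -> (forall n, t n <= r) ->
  (forall i j, (i < j)%N -> t i = 0 \/ 2 * t j <= t i) ->
  forall n, \sum_(k < n) t k <= 2 * r.
Proof.
move=> t0 tr halve n.
elim: n t r t0 tr halve => [|n IH] t r t0 tr halve.
  by rewrite big_ord0 mulr_ge0// (le_trans (t0 0%N)).
rewrite big_ord_recl /=.
have halve' i j : (i < j)%N -> t i.+1 = 0 \/ 2 * t j.+1 <= t i.+1.
  by move=> ij; exact: halve.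
have [t00|t0_neq0] := eqVneq (t 0%N) 0.
  by rewrite t00 add0r; apply: (IH (t \o S)) => // k; [exact: t0|exact: tr].
have : \sum_(k < n) t k.+1 <= 2 * (t 0%N / 2).
  apply: (IH (t \o S)) => // k /=; first exact: t0.
  by have [/eqP|] := halve 0%N k.+1 isT; [rewrite (negbTE t0_neq0) | lra].
by have := tr 0%N; lra.
Qed.

Section ball_system.
Context {R : realType} {M : metricType R} (o : M) (x : nat -> M).
Context (Multra : ultrametric M).
Implicit Types (y z : M) (n k : nat) (f : M -> R).

Definition dyadic_dist y z : R := dyadic (mdist y z).
Local Notation rho := dyadic_dist.

Lemma dyadic_distC y z : rho y z = rho z y.
Proof. by rewrite /rho metric_sym. Qed.

Lemma dyadic_dist_ultra y z u : rho y u <= Num.max (rho y z) (rho z u).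
Proof.
have := Multra y z u; rewrite !le_max /rho.
by move=> /orP[]/le_dyadic->; rewrite ?orbT.
Qed.

Lemma mdist_le_dyadic y z : mdist y z <= rho y z.
Proof. exact: dyadic_ge. Qed.

Lemma dyadic_dist_le y z : rho y z <= 2 * mdist y z.
Proof. exact/dyadic_le/mdist_ge0. Qed.

Let rhoC := dyadic_distC.
Let rho_ultra := dyadic_dist_ultra.

Lemma dyadic_dist_ge0 y z : 0 <= rho y z.
Proof. exact: dyadic_ge0. Qed.

Lemma dyadic_distxx y : rho y y = 0.
Proof. by rewrite /rho mdistxx dyadic0. Qed.

Definition retr n y := nearest rho o (mkseq x n) y.

Lemma retrS n y :
  retr n.+1 y = if rho y (x n) < rho y (retr n y) then x n else retr n y.
Proof. by rewrite /retr mkseqS nearest_rcons. Qed.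

Lemma retr_le_origin n y : rho y (retr n y) <= rho y o.
Proof. by apply: nearest_le; rewrite mem_head. Qed.

Lemma retr_le n k y : (k < n)%N -> rho y (retr n y) <= rho y (x k).
Proof.
by move=> kn; apply: nearest_le; rewrite in_cons map_f ?orbT// mem_iota.
Qed.

Lemma retr_in n y : retr n y = o \/ exists2 k, (k < n)%N & retr n y = x k.
Proof.
have := nearest_mem rho o (mkseq x n) y.
rewrite -/(retr n y) in_cons => /orP[/eqP->|/mapP[k kn ->]]; first by left.
by right; exists k => //; move: kn; rewrite mem_iota.
Qed.

Definition parent n := retr n (x n).

(** A point of the sequence that repeats an earlier one has gap [0]; its spike
    and, as [1 / 0 = 0], its coefficients vanish. *)
Definition gap n := rho (x n) (parent n).

Definition spike n y := if rho y (x n) < gap n then gap n else 0.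

Definition coef f n := (f (x n) - f (parent n)) / gap n.

Lemma gap_ge0 n : 0 <= gap n. Proof. exact: dyadic_dist_ge0. Qed.

Lemma spike_ge0 n y : 0 <= spike n y.
Proof. by rewrite /spike; case: ifP => // _; exact: gap_ge0. Qed.

(** A point [y] of the ball of radius [gap n] around [x n] has the same
    distance as [x n] to the earlier points, hence the same nearest one. *)
Lemma closer_parent n y : rho y (x n) < gap n -> retr n y = parent n.
Proof. by rewrite rhoC /gap /parent => /nearest_local; exact. Qed.

Lemma closer_gap n y : rho y (x n) < rho y (retr n y) ->
  rho y (retr n y) = gap n.
Proof.
move=> yn; rewrite /gap /parent.
have -> : retr n (x n) = retr n y by exact: nearest_local yn.
by rewrite (ultra_isosceles _ _ yn).
Qed.

(** The ball carrying the [n]-th spike consists of the points that change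
    their nearest point when [x n] is appended to the list. *)
Lemma in_ballE n y : (rho y (x n) < gap n) = (rho y (x n) < rho y (retr n y)).
Proof.
apply/idP/idP => yn; last by rewrite -(closer_gap yn).
rewrite (closer_parent yn); suff -> : rho y (parent n) = gap n by [].
by apply: ultra_isosceles => //; rewrite rhoC.
Qed.

(** Step [n] of the retractions moves the points of the [n]-th ball, and moves
    them all from the parent of [x n] to [x n]. *)
Lemma coef_spike f n y : coef f n * spike n y = f (retr n.+1 y) - f (retr n y).
Proof.
rewrite retrS -in_ballE /spike.
case: ifPn => [yn|_]; last by rewrite mulr0 subrr.
rewrite (closer_parent yn) /coef divfK// gt_eqF// (le_lt_trans _ yn)//.
exact: dyadic_dist_ge0.
Qed.

Lemma sum_coef_spike f n y :
  \sum_(k < n) coef f k * spike k y = f (retr n y) - f o.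
Proof.
elim: n => [|n IH]; first by rewrite big_ord0 subrr.
by rewrite big_ord_recr IH/= coef_spike addrC subrKA.
Qed.

Lemma spike_le_origin n y : spike n y <= rho y o.
Proof.
rewrite /spike; case: ifPn => [|_]; last exact: dyadic_dist_ge0.
by rewrite in_ballE => yn; rewrite -(closer_gap yn) retr_le_origin.
Qed.

(** The earlier point [x k] competed with the parent of [x n]. *)
Lemma spike_le n k y : (k < n)%N -> spike n y <= rho y (x k).
Proof.
move=> kn; rewrite /spike; case: ifPn => [|_]; last exact: dyadic_dist_ge0.
by rewrite in_ballE => yn; rewrite -(closer_gap yn) retr_le.
Qed.

Lemma spike_origin n : spike n o = 0.
Proof.
apply/eqP; rewrite eq_le spike_ge0 (le_trans (spike_le_origin _ _))//.
by rewrite dyadic_distxx.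
Qed.

Lemma spike_later n k : (k < n)%N -> spike n (x k) = 0.
Proof.
move=> kn; apply/eqP.
by rewrite eq_le spike_ge0 (le_trans (spike_le _ kn))// dyadic_distxx.
Qed.

Lemma spike_self n : spike n (x n) = gap n.
Proof.
rewrite /spike dyadic_distxx; case: ltP => // g0.
by apply/eqP; rewrite eq_le gap_ge0.
Qed.

(** If [y] lies in both balls, then [gap j <= rho y (x i) < gap i], because
    [x i] was available when the parent of [x j] was chosen. *)
Lemma spike_halving i j y :
  (i < j)%N -> spike i y = 0 \/ 2 * spike j y <= spike i y.
Proof.
move=> ij; have := spike_le y ij; rewrite {2 4}/spike.
case: ifPn => [yi yj|_ _]; [right|by left].
have := le_lt_trans yj yi; rewrite /spike.
case: ifPn => _; last by rewrite mulr0 gap_ge0.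
exact: lt_dyadic.
Qed.

Lemma sum_spike_le n y : \sum_(k < n) spike k y <= 2 * rho y o.
Proof.
apply: (@halving_sum_le _ (spike ^~ y)) => [k|k|i j].
- exact: spike_ge0.
- exact: spike_le_origin.
- exact: spike_halving.
Qed.

Lemma spike_local n y z : rho y z < gap n -> spike n y = spike n z.
Proof.
move=> yz; rewrite /spike; congr (if _ then _ else _).
apply/idP/idP => yn.
  by apply: le_lt_trans (rho_ultra z y (x n)) _; rewrite gt_max (rhoC z) yz.
by apply: le_lt_trans (rho_ultra y z (x n)) _; rewrite gt_max yz.
Qed.

(** A ball of radius greater than [rho y z] contains both or none of [y] and
    [z], so only the spikes of height at most [rho y z] contribute; those that
    do not vanish at [y], and those that do not vanish at [z], have heights
    decreasing geometrically. *)
Lemma sum_spike_change n y z :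
  \sum_(k < n) `|spike k y - spike k z| <= 4 * rho y z.
Proof.
(* t u is the sequence of the spike values at u that the pair y, z can see. *)
pose t u k := if gap k <= rho y z then spike k u else 0.
have t_sum u : \sum_(k < n) t u k <= 2 * rho y z.
  apply: (@halving_sum_le _ (t u)) => [k|k|i j ij]; rewrite /t.
  - by case: ifP => // _; exact: spike_ge0.
  - case: ifPn => [|_]; last exact: dyadic_dist_ge0.
    by rewrite /spike; case: ifPn => // _ _; exact: dyadic_dist_ge0.
  - case: ifPn => _; [|by left].
    case: ifPn => _; first exact: spike_halving.
    by right; rewrite mulr0 spike_ge0.
have : \sum_(k < n) `|spike k y - spike k z| <=
       \sum_(k < n) t y k + \sum_(k < n) t z k.
  rewrite -big_split/=; apply: ler_sum => k _; rewrite /t; case: ifPn => [_|].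
    by rewrite (le_trans (ler_normB _ _))// !ger0_norm ?spike_ge0.
  by rewrite -ltNge => /spike_local->; rewrite subrr normr0 addr0.
have := t_sum y; have := t_sum z; lra.
Qed.

End ball_system.

(** * Lipschitz functions and the subspace S *)

Section lipschitz_functions.
Context {R : realType} {M : metricType R} (o : M).
Local Notation flat := (lip0_flat (o := o)).
Implicit Types (f g : Lip0 o) (y z : M).

Lemma Lip0_mem (f : M -> R^o) k : f o = 0 ->
  (forall y z, `|f y - f z| <= k * mdist y z) -> f \in Lip0_pred o.
Proof. by move=> fo fk; apply/asboolP; split=> //; exists k. Qed.

Definition mkLip0 (f : M -> R^o) k (fo : f o = 0)
    (fk : forall y z, `|f y - f z| <= k * mdist y z) : Lip0 o :=
  exist (fun h => h \in Lip0_pred o) f (Lip0_mem fo fk).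

Lemma Lip0_origin f : f o = 0. Proof. by have [] := Lip0P f. Qed.

Lemma Lip0_funB f g y : (f - g : Lip0 o) y = f y - g y. Proof. by []. Qed.

Lemma Lip0_norm_le f k : 0 <= k ->
  (forall y z, `|f y - f z| <= k * mdist y z) -> `|f| <= k.
Proof.
move=> k0 fk; rewrite Lip0_normE; apply: sup_le_nneg => // _ [[y z] /= yz <-].
rewrite /slope/= normrM normfV (ger0_norm (mdist_ge0 _ _)).
by rewrite ler_pdivrMr ?mdist_gt0.
Qed.

Lemma Lip0_le_origin f y : `|f y| <= `|f| * mdist y o.
Proof. by have := Lip0_le f y o; rewrite Lip0_origin subr0. Qed.

Lemma lip0_flatP f : reflect
  (lip0 f /\ forall e : R, 0 < e ->
    \forall r \near +oo, forall p, outer_pairs o r p -> `|slope f p| <= e)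
  (f \in flat).
Proof.
by apply: (iffP (asboolP _)) => -[lf fl]; split => //; apply/outer_slopeP.
Qed.

(** This is what lets sums of infinitely many spikes belong to [S]. *)
Lemma lip0_flat_closed f :
  (forall e : R, 0 < e -> exists2 g, g \in flat & `|f - g| <= e) ->
  f \in flat.
Proof.
move=> approx; apply/lip0_flatP; split => [e e0|e e0];
  (have e2 : 0 < e / 2 by rewrite divr_gt0);
  have [g /lip0_flatP[lg fg] gf] := approx _ e2.
- have [d d0 gd] := lg _ e2; exists d => // y z /gd gyz.
  have := Lip0_le (f - g) y z; rewrite /= => fgyz.
  have -> : f y - f z = (g y - g z) + ((f y - g y) - (f z - g z)) by ring.
  apply: le_trans (ler_normD _ _) _.
  rewrite [e]splitr mulrDl lerD// (le_trans fgyz)//.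
  by rewrite ler_wpM2r// mdist_ge0.
- have := fg _ e2; apply: filterS => r gr p /gr gp.
  have -> : f = g + (f - g) by rewrite addrC subrK.
  rewrite slopeD (le_trans (ler_normD _ _))// [e]splitr lerD//.
  exact: le_trans (slope_le _ _) gf.
Qed.

(** Small pairs have slope [0].  A pair reaching beyond distance [q >= r] of the
    origin has slope [0] unless its other point is within [r] of the origin, in
    which case the two points are more than [q] apart while the values of [f]
    differ by at most [`|f| * r]. *)
Lemma locally_constant_flat (Multra : ultrametric M) f s r : 0 < s ->
  (forall y z, mdist y z < s -> f y = f z) ->
  (forall y, r < mdist o y -> f y = 0) -> f \in flat.
Proof.
move=> s0 fs fr; apply/lip0_flatP; split=> [e e0|e e0].
  exists s => // y z /fs->; rewrite subrr normr0.
  by rewrite mulr_ge0 ?mdist_ge0 ?ltW.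
have far q y z : r <= q -> `|f| * r / e <= q -> 0 < q -> q < mdist o y ->
    `|f y - f z| / mdist y z <= e.
  move=> rq feq q0 qy; rewrite fr ?(le_lt_trans rq)// sub0r normrN.
  have [/fr->|zr] := ltP r (mdist o z).
    by rewrite normr0 mul0r ltW.
  have qyz : q < mdist y z.
    have := Multra o z y; rewrite le_max => /orP[|].
      by move=> /(lt_le_trans qy)/lt_le_trans/(_ zr); rewrite ltNge rq.
    by rewrite (metric_sym z); exact: lt_le_trans.
  rewrite ler_pdivrMr; last exact: lt_trans qyz.
  apply: le_trans (Lip0_le_origin f z) _.
  apply: (@le_trans _ _ (`|f| * r)); first by rewrite ler_wpM2l// metric_sym.
  rewrite -ler_pdivrMl// mulrC; exact: le_trans feq (ltW qyz).
near=> q => -[y z] [/= yz yqz].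
have rq : r <= q by near: q; apply: nbhs_pinfty_ge; exact: num_real.
have feq : `|f| * r / e <= q by near: q; apply: nbhs_pinfty_ge; exact: num_real.
have q0 : 0 < q by near: q; apply: nbhs_pinfty_gt; exact: num_real.
rewrite /slope normrM normfV (ger0_norm (mdist_ge0 _ _)).
case: yqz => /negP; rewrite -ltNge => qo; first exact: (far q).
by rewrite distrC metric_sym; exact: (far q).
Unshelve. all: by end_near. Qed.

End lipschitz_functions.

(** * Expansion of Lipschitz functions along the ball system *)

Lemma sum_ord_tail (R : zmodType) (w : nat -> R) m n : (m <= n)%N ->
  \sum_(k < n) w k - \sum_(k < m) w k = \sum_(m <= k < n) w k.
Proof.
move=> mn; rewrite -!(big_mkord xpredT w) (big_cat_nat (leq0n m) mn)/=.
by rewrite addrAC subrr add0r.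
Qed.

Lemma lim_norm_le (R : realType) (w : nat -> R) (C : R) :
  cvgn w -> (\forall n \near \oo, `|w n| <= C) -> `|limn w| <= C.
Proof.
move=> cw wC; rewrite -lim_norm//; apply: limr_le => //.
exact: is_cvg_norm.
Qed.

Lemma abs_cvg (R : realType) (w : nat -> R) (C : R) :
  (forall n, \sum_(k < n) `|w k| <= C) -> cvgn (fun n => \sum_(k < n) w k).
Proof.
move=> wC; suff : cvgn (series w) by rewrite seriesEord.
apply: normed_cvg; apply: nondecreasing_is_cvgn.
  by apply: nondecreasing_series => k _ _; exact: normr_ge0.
by exists C => _ [n _ <-]; rewrite /= /series/= big_mkord.
Qed.

(** The point [p] makes [T] a pointed space, for which compactness is the
    extraction of finite subcovers. *)
Lemma compact_cover_compact (T : topologicalType) (p : T) (A : set T) :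
  compact A -> cover_compact A.
Proof.
pose pointedT := isPointed.Build T p.
pose pT : ptopologicalType := HB.pack T pointedT.
by rewrite -[compact A]/(@compact pT A) compact_cover.
Qed.

Section expansion.
Context {R : realType} {M : metricType R} (o : M) (x : nat -> M).
Context (Multra : ultrametric M).
Implicit Types (y z : M) (n k : nat) (u v : nat -> R) (f : Lip0 o).
Local Notation rho := (@dyadic_dist R M).
Local Notation spike := (spike o x).
Local Notation gap := (gap o x).
Local Notation retr := (retr o x).
Local Notation parent := (parent o x).
Local Notation coef := (coef o x).
Local Notation flat := (lip0_flat (o := o)).

Definition psum u n y : R := \sum_(k < n) u k * spike k y.

Definition synth u y : R := limn (psum u ^~ y).

Lemma psum_cvg u C y : (forall n, `|u n| <= C) -> cvgn (psum u ^~ y).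
Proof.
move=> uC; apply: (@abs_cvg _ (fun k => u k * spike k y) (C * (2 * rho y o))).
move=> n; apply: (@le_trans _ _ (C * \sum_(k < n) spike k y)).
  rewrite mulr_sumr; apply: ler_sum => k _.
  by rewrite normrM (ger0_norm (spike_ge0 _ _ _ _)) ler_wpM2r// spike_ge0.
by rewrite ler_wpM2l ?sum_spike_le// (le_trans _ (uC 0%N)).
Qed.

Lemma psum_lip u C n y z : (forall k, `|u k| <= C) ->
  `|psum u n y - psum u n z| <= 4 * C * rho y z.
Proof.
move=> uC; rewrite /psum -sumrB; apply: le_trans (ler_norm_sum _ _ _) _.
apply: (@le_trans _ _ (C * \sum_(k < n) `|spike k y - spike k z|)).
  rewrite mulr_sumr; apply: ler_sum => k _.
  by rewrite -mulrBr normrM ler_wpM2r.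
rewrite (mulrC 4) -mulrA ler_wpM2l ?sum_spike_change//.
exact: le_trans (uC 0%N).
Qed.

(** The constant [8] is [4], the constant for the rounded distance, times the
    factor [2] lost in the rounding. *)
Lemma synth_lip u C y z : (forall k, `|u k| <= C) ->
  `|synth u y - synth u z| <= 8 * C * mdist y z.
Proof.
move=> uC; have C0 : 0 <= C by exact: le_trans (uC 0%N).
apply: (@le_trans _ _ (4 * C * rho y z)); last first.
  have := dyadic_dist_le y z => /(ler_wpM2l C0); lra.
rewrite /synth -limB; [|exact: psum_cvg uC..].
apply: lim_norm_le; first exact: is_cvgB (psum_cvg uC) (psum_cvg uC).
by apply: nearW => n /=; exact: psum_lip.
Qed.

Lemma psum_origin u n : psum u n o = 0.
Proof. by rewrite /psum big1// => k _; rewrite spike_origin ?mulr0. Qed.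

Lemma synth_origin u : synth u o = 0.
Proof.
rewrite /synth (_ : psum u ^~ o = cst 0) ?lim_cst//.
by apply/funext => n; exact: psum_origin.
Qed.

Definition prefix_part u n : nat -> R := fun k => if (k < n)%N then u k else 0.
Definition suffix_part u n : nat -> R := fun k => if (k < n)%N then 0 else u k.

Lemma synth_linear a u v C D y :
  (forall k, `|u k| <= C) -> (forall k, `|v k| <= D) ->
  synth (fun k => a * u k + v k) y = a * synth u y + synth v y.
Proof.
move=> uC vD; rewrite /synth.
have cu := psum_cvg (y := y) uC; have cv := psum_cvg (y := y) vD.
have -> : psum (fun k => a * u k + v k) ^~ y =
    (fun n => a * psum u n y + psum v n y).
  apply/funext => n; rewrite /psum /= mulr_sumr -big_split/=.
  by apply: eq_bigr => k _; rewrite mulrDl -mulrA.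
by apply: cvg_lim => //; apply: cvgD => //; apply: cvgM => //; exact: cvg_cst.
Qed.

Lemma synth_prefix u n y : synth (prefix_part u n) y = psum u n y.
Proof.
apply: cvg_lim => //; apply: cvg_near_cst; near=> m.
have nm : (n <= m)%N by near: m; exact: nbhs_infty_ge.
rewrite /psum [RHS](big_ord_widen m (fun k => u k * spike k y))//.
rewrite [RHS]big_mkcond.
by apply: eq_bigr => k _; rewrite /prefix_part; case: ifP => //; rewrite mul0r.
Unshelve. all: by end_near. Qed.

Lemma synth_suffix u C n y : (forall k, `|u k| <= C) ->
  synth (suffix_part u n) y = synth u y - psum u n y.
Proof.
move=> uC; have hC k : `|prefix_part u n k| <= C.
  rewrite /prefix_part; case: ifP => // _; rewrite normr0.
  exact: le_trans (uC 0%N).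
rewrite -synth_prefix addrC -mulN1r -(synth_linear _ _ hC uC); congr synth.
by apply/funext => k; rewrite /suffix_part /prefix_part; case: ifP => _; ring.
Qed.

Lemma spike_lip n y z : `|spike n y - spike n z| <= 8 * mdist y z.
Proof.
have := dyadic_dist_le y z; have := sum_spike_change o x Multra n.+1 y z.
rewrite big_ord_recr/=; set s := \sum_(_ < _) _.
have : 0 <= s by exact: sumr_ge0.
lra.
Qed.

Definition spike_Lip0 n : Lip0 o :=
  mkLip0 (spike_origin o x Multra n) (spike_lip n).

(** The spike is constant at scales below its height, and its ball is
    bounded. *)
Lemma spike_flat n : spike_Lip0 n \in flat.
Proof.
have [g0|] := ltP 0 (gap n); last first.
  move=> g0; suff -> : spike_Lip0 n = 0 by exact: rpred0.
  apply: val_inj; apply/funext => y; apply/eqP.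
  rewrite eq_le spike_ge0 andbT /=.
  by rewrite /spike; case: ifP.
apply: (@locally_constant_flat _ _ _ Multra _ (gap n / 2)
  (gap n + mdist o (x n))); first by rewrite divr_gt0.
  move=> y z yz; apply: spike_local => //.
  apply: le_lt_trans (dyadic_dist_le _ _) _.
  by rewrite mulrC -ltr_pdivlMr.
move=> y yr; rewrite -[LHS]/(spike n y) /spike ifF//.
apply/negbTE; rewrite -leNgt.
apply: le_trans (mdist_le_dyadic _ _); rewrite metric_sym.
have := metric_triangle o (x n) y; lra.
Qed.

Definition synth_Lip0 u C (uC : forall k, `|u k| <= C) : Lip0 o :=
  mkLip0 (synth_origin u) (fun y z => synth_lip y z uC).

Lemma psum_flat u n :
  exists2 g : Lip0 o, g \in flat & forall y, g y = psum u n y.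
Proof.
exists (\sum_(k < n) u k *: spike_Lip0 k).
  by apply: rpred_sum => k _; rewrite rpredZ// spike_flat.
move=> y; rewrite /psum; elim: n => [|n IH]; first by rewrite !big_ord0.
by rewrite !big_ord_recr/= Lip0_funD IH.
Qed.

(** When [u] tends to [0] the partial sums, which lie in [S], converge in
    Lipschitz norm, since the remainders are sums with small coefficients. *)
Lemma synth_flat u C (uC : forall k, `|u k| <= C) :
  u @ \oo --> 0 -> synth_Lip0 uC \in flat.
Proof.
move=> u0; apply: lip0_flat_closed => e e0.
have e8 : 0 < e / 8 by rewrite divr_gt0.
move/cvgr0Pnorm_le : u0 => /(_ _ e8)[n _ un].
have [g gflat gE] := psum_flat u n; exists g => //.
apply: Lip0_norm_le; first exact: ltW.
move=> y z; rewrite !Lip0_funB !gE -!(synth_suffix n _ uC).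
have te k : `|suffix_part u n k| <= e / 8.
  rewrite /suffix_part; case: ltnP => [_|/un//]; first by rewrite normr0 ltW.
by have := synth_lip y z te; rewrite mulrCA divff// mulr1.
Qed.

Context (Mproper : proper_metric M).
Context (xdense : forall y (e : R), 0 < e ->
  mdist o y < e \/ exists n, mdist (x n) y < e).

(** A finite initial segment of the sequence is [e]-dense in a given ball, by
    compactness; the points of the ball that come later have small gaps. *)
Lemma cball_net (r e : R) : 0 < e ->
  exists n, forall y, cball o r y ->
    mdist o y < e \/ exists2 k, (k < n)%N & mdist (x k) y < e.
Proof.
move=> e0; have e2 : 0 < e / 2 by rewrite divr_gt0.
have ball_int a y : mdist a y < e / 2 -> (ball a e)^° y.
  move=> ay; apply/nbhs_ballP; exists (e / 2) => //= z.
  rewrite !ballEmdist/= => yz; have := metric_triangle a y z; lra.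
have /(compact_cover_compact o) := @Mproper o r.
move=> /(_ nat setT (fun n => (ball o e)^° `|` (ball (x n) e)^°)) [].
- by move=> n _; apply: openU; exact: open_interior.
- move=> y _; have [oy|[n ny]] := xdense y e2.
    by exists 0%N => //; left; exact: ball_int.
  by exists n => //; right; exact: ball_int.
move=> D _ cov; exists (\max_(k <- finmap.enum_fset D) k).+1 => y /cov[k /= kD].
move=> [|] /interior_subset; rewrite ballEmdist/= => yk; [by left|right].
by exists k => //; rewrite ltnS; exact: (@leq_bigmax_seq _ _ xpredT id).
Qed.

Lemma retr_cvg y : mdist y (retr n y) @[n --> \oo] --> 0.
Proof.
apply/cvgrPdist_le => e e0; have e2 : 0 < e / 2 by rewrite divr_gt0.
have near_le n a : rho y (retr n y) <= rho y a -> mdist a y < e / 2 ->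
    `|0 - mdist y (retr n y)| <= e.
  move=> ya; rewrite sub0r normrN ger0_norm ?mdist_ge0// metric_sym.
  by have := mdist_le_dyadic y (retr n y); have := dyadic_dist_le y a; lra.
have [oe|[k ke]] := xdense y e2.
  by near=> n; apply: near_le oe; exact: retr_le_origin.
near=> n; apply: near_le ke; apply: retr_le.
by near: n; exact: nbhs_infty_gt.
Unshelve. all: by end_near. Qed.

Lemma coef_le f n : `|coef f n| <= `|f|.
Proof.
rewrite /coef normrM normfV (ger0_norm (gap_ge0 _ _ _)).
have [->|g0] := eqVneq (gap n) 0; first by rewrite invr0 mulr0.
rewrite ler_pdivrMr ?lt_def ?g0 ?gap_ge0//.
by apply: le_trans (Lip0_le _ _ _) _; rewrite ler_wpM2l// mdist_le_dyadic.
Qed.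

Lemma coef_linear a (f g : Lip0 o) k :
  coef (a *: f + g : Lip0 o) k = a * coef f k + coef g k.
Proof. by rewrite /coef !Lip0_funD !Lip0_funZ; ring. Qed.

Lemma psum_coef f n y : psum (coef f) n y = f (retr n y).
Proof. by rewrite /psum sum_coef_spike// Lip0_origin subr0. Qed.

(** The partial sums are the values of [f] at the retractions of [y], which
    converge to [y] by density. *)
Lemma synth_coef f y : synth (coef f) y = f y.
Proof.
apply: cvg_lim => //; apply/cvgrPdist_le => e e0.
have e1 : 0 < e / (`|f| + 1) by rewrite divr_gt0// ltr_wpDl.
have := retr_cvg y; move/cvgrPdist_le => /(_ _ e1); apply: filterS => n.
rewrite sub0r normrN ger0_norm ?mdist_ge0// psum_coef => pe.
apply: le_trans (Lip0_le _ _ _) _.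
move: pe; rewrite ler_pdivlMr ?ltr_wpDl//; apply: le_trans.
by rewrite mulrC ler_wpM2l ?mdist_ge0// lerDl.
Qed.

(** For [m] large, [x m] either lies outside a ball beyond which the slopes of
    [f] are small, or has an earlier point very near to it by [cball_net]; in
    the latter case its parent is so near that the slope is small because [f]
    is in [lip_0]. *)
Lemma coef_cvg0 f : f \in flat -> coef f @ \oo --> 0.
Proof.
move=> /lip0_flatP[lf fl]; apply/cvgr0Pnorm_le => e e0.
have [d d0 fd] := lf _ e0.
have /filter_ex[r fr] := fl _ e0.
have [n net] := @cball_net r (d / 2) ltac:(by rewrite divr_gt0).
near=> m; have nm : (n <= m)%N by near: m; exact: nbhs_infty_ge.
have coefE : `|coef f m| = `|f (x m) - f (parent m)| / gap m.
  by rewrite /coef normrM normfV (ger0_norm (gap_ge0 _ _ _)).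
have [g0|g_neq0] := eqVneq (gap m) 0.
  by rewrite coefE g0 invr0 mulr0 ltW.
have g_gt0 : 0 < gap m by rewrite lt_def g_neq0 gap_ge0.
have xp : x m != parent m.
  by apply: contra_neq g_neq0; rewrite /gap => <-; exact: dyadic_distxx.
have mdist_gap : mdist (x m) (parent m) <= gap m by exact: mdist_le_dyadic.
(* Either the pair reaches out of the ball of radius r, or x m lies in it. *)
have [|in_r] := pselect (outer_pairs o r (x m, parent m)).
  move=> /fr; apply: le_trans; rewrite coefE /slope/= normrM normfV.
  rewrite ler_wpM2l// (ger0_norm (mdist_ge0 _ _)) lef_pV2// posrE.
  by rewrite mdist_gt0.
have xr : cball o r (x m).
  by apply: contrapT => xr; apply: in_r; split => //; left.
have gap_lt a : rho (x m) (parent m) <= rho (x m) a -> mdist a (x m) < d / 2 ->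
    gap m < d.
  have := dyadic_dist_le (x m) a; rewrite (metric_sym a) /gap; lra.
have gd : gap m < d.
  have [|[k kn]] := net _ xr; apply: gap_lt; first exact: retr_le_origin.
  by apply: retr_le; exact: leq_trans nm.
rewrite coefE ler_pdivrMr//; apply: le_trans (fd _ _ _) _.
  exact: le_lt_trans gd.
by rewrite ler_wpM2l// ltW.
Unshelve. all: by end_near. Qed.

End expansion.

(** * Dense sequences in proper metric spaces *)

Section dense_sequence.
Context {R : realType} {M : metricType R} (o : M).
Context (Mproper : proper_metric M).

Lemma proper_totally_bounded (r e : R) : 0 < e ->
  exists s : seq M, forall y, cball o r y -> exists2 a, a \in s & mdist a y < e.
Proof.
move=> e0; have /(compact_cover_compact o) := @Mproper o r.
move=> /(_ M setT (fun a => (ball a e)^°)) [].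
- by move=> a _; exact: open_interior.
- by move=> y _; exists y => //; exact: nbhsx_ballx.
move=> D _ cov; exists (finmap.enum_fset D) => y /cov[a /= aD].
by move=> /interior_subset; rewrite ballEmdist/= => ay; exists a.
Qed.

Lemma proper_dense_sequence : exists x : nat -> M,
  forall y (e : R), 0 < e -> exists n, mdist (x n) y < e.
Proof.
have net (kj : nat * nat) : exists s : seq M, forall y, cball o kj.1%:R y ->
    exists2 a, a \in s & mdist a y < kj.2.+1%:R^-1.
  by apply: proper_totally_bounded; rewrite invr_gt0.
have [s sP] := choice net.
pose x n := if unpickle n is Some (kj, i) then nth o (s kj) i else o.
exists x => y e e0.
have [k yk] : exists k : nat, mdist o y <= k%:R.
  exists (Num.truncn (mdist o y)).+1; exact/ltW/truncnS_gt.
have [j je] : exists j : nat, j.+1%:R^-1 < e.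
  exists (Num.truncn e^-1); rewrite invf_plt ?posrE//; exact: truncnS_gt.
have [a as_ ay] := sP (k, j) y yk.
exists (pickle ((k, j), index a (s (k, j)))).
by rewrite /x pickleK nth_index//; exact: lt_trans je.
Qed.

(** Repetitions and the origin are removed from a dense sequence.  Infinitely
    many points remain, because a finite set is closed and so is dense in [M]
    only if it is [M]. *)
Lemma proper_dense_injection : infinite_set [set: M] ->
  exists x : nat -> M, [/\ injective x, forall n, x n != o &
    forall y (e : R), 0 < e -> mdist o y < e \/ exists n, mdist (x n) y < e].
Proof.
move=> Minf; have [d dense] := proper_dense_sequence.
pose D := range d `\` [set o].
have Dinf : infinite_set D.
  move=> Dfin; apply: Minf.
  have Efin : finite_set (D `|` [set o]) by rewrite finite_setU; split.
  suff -> : [set: M] = D `|` [set o] by [].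
  have Ecl : closed (D `|` [set o]).
    have accM := hausdorff_accessible (@metric_hausdorff _ M).
    by have /accessible_finite_set_closed := accM; exact.
  apply/esym; rewrite -subTset => y _.
  apply: Ecl => B /nbhs_ballP[e /= e0 eB].
  have [n ny] := dense y e e0; exists (d n); split.
    by have [->|/eqP ?] := eqVneq (d n) o; [right|left; split => //; exists n].
  by apply: eB; rewrite ballEmdist/= metric_sym.
have Dcount : countable D.
  apply: sub_countable (subset_card_le (@subDsetl _ _ _)) _.
  exact: card_image_le.
have /card_set_bijP[f [_ finj fsurj]] := eq_card_nat Dcount Dinf.
have /choice[x xP] : forall n, exists y, D y /\ f y = n.
  by move=> n; have [y Dy <-] := fsurj n I; exists y.
exists x; split.
- by move=> n m nm; rewrite -(xP n).2 -(xP m).2 nm.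
- by move=> n; apply/eqP; have [[]] := xP n.
- move=> y e e0; have [n ny] := dense y e e0.
  have [dno|/eqP dno] := eqVneq (d n) o; first by left; rewrite -dno.
  have Ddn : D (d n) by split => //; exists n.
  right; exists (f (d n)); rewrite (_ : x _ = d n)//.
  by apply: finj; rewrite ?inE ?(xP _).2//; exact: (xP _).1.
Qed.

End dense_sequence.

(** * Restricting the free space to S is isometric *)

Lemma bounded_continuous (R : realType) (V W : normedModType R)
    (h : {linear V -> W}) k :
  (forall v, `|h v| <= k * `|v|) -> continuous h.
Proof.
move=> hk; apply: bounded_linear_continuous.
apply/bounded_funP => r; exists (`|k| * r) => v vr.
apply: le_trans (hk v) _; apply: (@le_trans _ _ (`|k| * `|v|)).
  by rewrite ler_wpM2r// ler_norm.
by rewrite ler_wpM2l.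
Qed.

Section dual_space.
Context {R : realType} {V : normedModType R}.
Implicit Types (phi psi : dual V) (v : V).

Lemma dual_mem (h : V -> R^o) k : linear h ->
  (forall v, `|h v| <= k * `|v|) -> h \in dual_pred (V := V).
Proof.
move=> hlin hk; apply/asboolP; split=> //.
pose hL := GRing.isLinear.Build R V R^o _ h hlin.
pose H : {linear V -> R^o} := HB.pack h hL.
exact: (bounded_continuous (h := H) hk).
Qed.

Definition mkdual (h : V -> R^o) k (hlin : linear h)
    (hk : forall v, `|h v| <= k * `|v|) : dual V :=
  exist (fun h => h \in dual_pred (V := V)) h (dual_mem hlin hk).

Lemma dual_norm_le phi k : 0 <= k -> (forall v, `|v| <= 1 -> `|phi v| <= k) ->
  `|phi| <= k.
Proof.
by move=> k0 phik; apply: sup_le_nneg => // _ [v v1 <-]; exact: phik.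
Qed.

Lemma dual_le phi v : `|phi v| <= `|phi| * `|v|.
Proof.
have [->|v0] := eqVneq v 0; first by rewrite linear0 !normr0 mulr0.
have v_gt0 : 0 < `|v| by rewrite normr_gt0.
rewrite -ler_pdivrMr// mulrC; apply: ub_le_sup; first exact: dual_bounded.
exists (`|v|^-1 *: v) => /=.
  by rewrite normrZ normfV normr_id mulVf// gt_eqF.
by rewrite linearZ/= normrM normfV normr_id.
Qed.

Lemma dual_sumE (I : Type) (s : seq I) (c : I -> R) (a : I -> dual V) v :
  (\sum_(i <- s) c i *: a i : dual V) v = \sum_(i <- s) c i * a i v.
Proof.
elim: s => [|i s IH]; first by rewrite !big_nil.
by rewrite !big_cons -IH.
Qed.

End dual_space.

Section restriction.
Context {R : realType} {M : metricType R} (o : M).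
Context (Multra : ultrametric M).
Local Notation flat := (lip0_flat (o := o)).

Lemma list_separation (s : seq M) : exists2 e : R, 0 < e &
  {in s &, forall a b, a != b -> e <= mdist a b}.
Proof.
suff [e e0 eP] : exists2 e : R, 0 < e &
    forall t, t \in [seq mdist a b | a <- s, b <- s] -> 0 < t -> e <= t.
  exists e => // a b as_ bs ab; apply: eP; rewrite ?mdist_gt0//.
  by apply/allpairsP; exists (a, b).
elim: [seq _ | _ <- _, _ <- _] => [|t l [e e0 IH]]; first by exists 1.
have [t0|t0] := ltP 0 t; last first.
  by exists e => // u; rewrite in_cons => /orP[/eqP->|/IH//]; rewrite ltNge t0.
exists (Num.min e t); first by rewrite lt_min e0.
move=> u; rewrite in_cons ge_min => /orP[/eqP->|/IH eu /eu->//].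
by rewrite lexx orbT.
Qed.

Lemma list_bounded (s : seq M) : exists r : R, {in s, forall a, mdist o a <= r}.
Proof.
elim: s => [|b s [r rP]]; first by exists 0.
exists (Num.max (mdist o b) r) => a; rewrite in_cons le_max.
by move=> /orP[/eqP->|/rP->]; rewrite ?lexx ?orbT.
Qed.

(** Compose [f] with the nearest-point retraction onto [o :: s].  It is
    [1]-Lipschitz, so the norm does not grow; it is constant at scales below
    the separation of [o :: s]; and it sends the points far from [o] to [o]. *)
Lemma flat_interpolation (s : seq M) (f : Lip0 o) : exists g : Lip0 o,
  [/\ g \in flat, `|g| <= `|f| & {in s, forall a, g a = f a}].
Proof.
pose p := nearest mdist o s.
have pMdist : p o = o.
  by apply: nearest_origin => a _; rewrite mdistxx mdist_ge0.
have p_lip y z : mdist (p y) (p z) <= mdist y z.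
  have [->|/eqP] := eqVneq (p y) (p z); first by rewrite mdistxx mdist_ge0.
  exact: (nearest_nonexpansive (@metric_sym _ M) Multra).
have fp_lip y z : `|f (p y) - f (p z)| <= `|f| * mdist y z.
  by apply: le_trans (Lip0_le _ _ _) _; rewrite ler_wpM2l.
have fpo : f (p o) = 0 by rewrite pMdist Lip0_origin.
pose g : Lip0 o := mkLip0 (f := fun y => f (p y)) fpo fp_lip.
exists g; split.
- have [e e0 sep] := list_separation (o :: s).
  have [r bounded] := list_bounded s.
  apply: (locally_constant_flat Multra (s := e) (r := r)) => // [y z yz|y yr].
    congr (f _); apply/eqP; apply: contraTT yz => pyz; rewrite -leNgt.
    by apply: le_trans (p_lip y z); apply: sep => //; exact: nearest_mem.
  rewrite -[g y]/(f (p y)) (_ : p y = o) ?Lip0_origin//.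
  apply: nearest_origin => a /bounded ar.
  have far := le_lt_trans ar yr.
  rewrite (metric_sym y a) (ultra_isosceles (@metric_sym _ M) Multra far).
  by rewrite metric_sym.
- exact: Lip0_norm_le.
- move=> a as_; congr (f _); apply/esym/mdist_positivity.
  apply/eqP; rewrite eq_le mdist_ge0 andbT -(mdistxx a).
  by apply: nearest_le; rewrite in_cons as_ orbT.
Qed.

Lemma span_finite_support (psi : dual (Lip0 o)) :
  linear_span (range (delta o)) psi ->
  exists s : seq M, forall f g : Lip0 o, {in s, f =1 g} -> psi f = psi g.
Proof.
move=> [n [c [a [a_delta ->]]]].
have /choice[p pE] : forall i, exists y, delta o y = a i.
  by move=> i; have [y _ <-] := a_delta i; exists y.
exists [seq p i | i <- enum 'I_n] => f g fg.
rewrite !dual_sumE; apply: eq_bigr => i _; rewrite -pE; congr (_ * _).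
by apply: fg; rewrite map_f// mem_enum.
Qed.

Lemma closed_span_approx (A : set (dual (Lip0 o))) (phi : dual (Lip0 o))
    (e : R) :
  phi \in closed_span A -> 0 < e ->
  exists2 psi : dual (Lip0 o), linear_span A psi & `|phi - psi| <= e.
Proof.
rewrite inE => /= cl e0; have [psi [Apsi]] := cl _ (nbhsx_ballx phi _ e0).
by rewrite -ball_normE /= => /ltW; exists psi.
Qed.

Definition free_dual (phi : lip_free o) : dual (Lip0 o) := val phi.

Definition free_restrict_fun (phi : lip_free o) : lip0_flat_space o -> R^o :=
  fun f => free_dual phi (val f).

Lemma free_restrict_linear (phi : lip_free o) : linear (free_restrict_fun phi).
Proof. by move=> a f g; rewrite /free_restrict_fun -linearP. Qed.

Lemma free_restrict_le (phi : lip_free o) f :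
  `|free_restrict_fun phi f| <= `|phi| * `|f|.
Proof. exact: dual_le. Qed.

Definition free_restrict (phi : lip_free o) : dual (lip0_flat_space o) :=
  mkdual (free_restrict_linear phi) (free_restrict_le phi).

Lemma free_restrict_is_linear : linear free_restrict.
Proof.
move=> a phi psi; apply: val_inj; apply/funext => f.
have -> : val (free_restrict (a *: phi + psi)) f =
    (a *: free_dual phi + free_dual psi : dual (Lip0 o)) (val f) by [].
by [].
Qed.

HB.instance Definition _ :=
  GRing.isLinear.Build R (lip_free o) (dual (lip0_flat_space o)) _
    free_restrict free_restrict_is_linear.

(** Up to [e], a functional of the free space depends on the values at
    finitely many points only; there each [f] coincides with a function of [S]
    of no larger norm, so nothing is lost by testing on [S]. *)
Lemma free_restrict_isometry phi : `|free_restrict phi| = `|phi|.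
Proof.
apply/eqP; rewrite eq_le; apply/andP; split.
  apply: dual_norm_le => // f f1; apply: le_trans (free_restrict_le phi f) _.
  by rewrite ler_piMr.
apply: (dual_norm_le (phi := free_dual phi)) => // f f1.
apply/ler_addgt0Pr => e e0; have e2 : 0 < e / 2 by rewrite divr_gt0.
have [psi psi_span psie] := closed_span_approx (valP phi) e2.
have [s psi_s] := span_finite_support psi_span.
have [g [gflat gf gE]] := flat_interpolation s f.
have psifg : psi f = psi g by apply: psi_s => a /gE.
have close h : `|h| <= 1 -> `|free_dual phi h - psi h| <= e / 2.
  move=> h1; apply: le_trans (dual_le (free_dual phi - psi) h) _.
  by apply: le_trans psie; rewrite ler_piMr.
have g1 : `|g| <= 1 by exact: le_trans f1.
have rg : `|free_dual phi g| <= `|free_restrict phi|.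
  pose gS : lip0_flat_space o := exist (fun h => h \in flat) g gflat.
  apply: le_trans (dual_le (free_restrict phi) gS) _.
  by rewrite ler_piMr.
have -> : free_dual phi f = free_dual phi g +
    ((free_dual phi f - psi f) - (free_dual phi g - psi g)).
  by rewrite psifg; ring.
apply: le_trans (ler_normD _ _) _; rewrite lerD// [e]splitr.
by apply: le_trans (ler_normB _ _) _; rewrite lerD// close.
Qed.

End restriction.

(** * Restricting the free space to S is onto *)

Section surjectivity.
Context {R : realType} {M : metricType R} (o : M) (x : nat -> M).
Context (Mproper : proper_metric M) (Multra : ultrametric M).
Context (xdense : forall y (e : R), 0 < e ->
  mdist o y < e \/ exists n, mdist (x n) y < e).
Local Notation S := (lip0_flat_space o).
Local Notation spike := (spike o x).
Local Notation coef := (coef o x).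
Local Notation psum := (psum o x).
Local Notation synth := (synth o x).

Definition to_Lip0 (f : S) : Lip0 o := val f.

Definition spike_flat_space n : S :=
  exist (fun f => f \in lip0_flat (o := o)) (spike_Lip0 o x Multra n)
    (spike_flat o x Multra n).

Definition psum_flat_space (u : nat -> R) n : S :=
  \sum_(k < n) u k *: spike_flat_space k.

Lemma psum_flat_spaceE u n y :
  to_Lip0 (psum_flat_space u n) y = psum u n y.
Proof.
rewrite /psum_flat_space /psum; elim: n => [|n IH]; first by rewrite !big_ord0.
by rewrite !big_ord_recr/= -IH.
Qed.

(** The upper c_0-estimate for the spikes. *)
Lemma psum_norm_le u C n : (forall k, `|u k| <= C) ->
  `|psum_flat_space u n| <= 8 * C.
Proof.
move=> uC; have C0 : 0 <= C by exact: le_trans (uC 0%N).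
apply: (Lip0_norm_le (f := to_Lip0 (psum_flat_space u n))).
  by rewrite mulr_ge0.
move=> y z; rewrite !psum_flat_spaceE.
apply: le_trans (psum_lip _ _ Multra n y z uC) _.
by have := dyadic_dist_le y z => /(ler_wpM2l C0); lra.
Qed.

Lemma psum_coef_cvg (f : S) :
  `|f - psum_flat_space (coef (to_Lip0 f)) n| @[n --> \oo] --> 0.
Proof.
have f0 := coef_cvg0 Mproper xdense (valP f).
apply/cvgr0Pnorm_le => e e0; have e8 : 0 < e / 8 by rewrite divr_gt0.
move/cvgr0Pnorm_le : f0 => /(_ _ e8); case=> N _ fN.
near=> n; have Nn : (N <= n)%N by near: n; exact: nbhs_infty_ge.
rewrite normr_id.
have te k : `|suffix_part (coef (to_Lip0 f)) n k| <= e / 8.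
  rewrite /suffix_part; case: ltnP => [_|nk]; first by rewrite normr0 ltW.
  by apply: fN => /=; exact: leq_trans nk.
apply: (Lip0_norm_le
  (f := to_Lip0 f - to_Lip0 (psum_flat_space (coef (to_Lip0 f)) n))).
  exact: ltW.
move=> y z; rewrite !Lip0_funB !psum_flat_spaceE.
rewrite -!(synth_coef Multra xdense (to_Lip0 f)).
rewrite -!(synth_suffix _ _ Multra n _ (coef_le x (to_Lip0 f))).
by have := synth_lip o x Multra y z te; rewrite mulrCA divff// mulr1.
Unshelve. all: by end_near. Qed.

Context (phi : dual S).

Definition weight n : R := phi (spike_flat_space n).

Lemma phi_psum u n : phi (psum_flat_space u n) = \sum_(k < n) u k * weight k.
Proof.
by rewrite linear_sum; apply: eq_bigr => k _; rewrite linearZ.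
Qed.

(** Test [phi] on the sum of the spikes with the signs of the weights, which
    has norm at most [8] whatever its length. *)
Lemma weight_summable n : \sum_(k < n) `|weight k| <= 8 * `|phi|.
Proof.
have -> : \sum_(k < n) `|weight k| =
    phi (psum_flat_space (fun k => Num.sg (weight k)) n).
  by rewrite phi_psum; apply: eq_bigr => k _; rewrite normrEsg.
apply: le_trans (ler_norm _) _; apply: le_trans (dual_le _ _) _.
rewrite mulrC ler_wpM2r// -[leRHS]mulr1; apply: psum_norm_le => k.
by rewrite normr_sg; case: eqP.
Qed.

Definition lift_sum (f : Lip0 o) n : R := \sum_(k < n) coef f k * weight k.

Lemma lift_abs (f : Lip0 o) n :
  \sum_(k < n) `|coef f k * weight k| <= 8 * `|phi| * `|f|.
Proof.
apply: (@le_trans _ _ (\sum_(k < n) `|f| * `|weight k|)).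
  by apply: ler_sum => k _; rewrite normrM ler_wpM2r// coef_le.
by rewrite -mulr_sumr mulrC ler_wpM2r// weight_summable.
Qed.

Lemma lift_cvg (f : Lip0 o) : cvgn (lift_sum f).
Proof. exact: (@abs_cvg _ (fun k => coef f k * weight k) _ (lift_abs f)). Qed.

(** The sum of the series of the functionals [f |-> coef f k], each a multiple
    of [delta (x k) - delta (parent k)], with the weights as coefficients; the
    formula makes sense on all Lipschitz functions. *)
Definition lift_fun (f : Lip0 o) : R^o := limn (lift_sum f).

Lemma lift_linear : linear lift_fun.
Proof.
move=> a f g; apply: cvg_lim => //.
have -> : lift_sum (a *: f + g) = (fun n => a * lift_sum f n + lift_sum g n).
  apply/funext => n; rewrite /lift_sum mulr_sumr -big_split/=.
  by apply: eq_bigr => k _; rewrite coef_linear; ring.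
apply: cvgD; last exact: lift_cvg.
by apply: cvgM; [exact: cvg_cst | exact: lift_cvg].
Qed.

Lemma lift_le (f : Lip0 o) : `|lift_fun f| <= 8 * `|phi| * `|f|.
Proof.
apply: lim_norm_le; first exact: lift_cvg.
apply: nearW => n; exact: le_trans (ler_norm_sum _ _ _) (lift_abs f n).
Qed.

Definition lift_dual : dual (Lip0 o) := mkdual lift_linear lift_le.

Lemma lift_sum_span n : exists2 psi : dual (Lip0 o),
  linear_span (range (delta o)) psi & forall f : Lip0 o, psi f = lift_sum f n.
Proof.
have span_delta y : linear_span (range (delta o)) (delta o y).
  exists 1%N, (fun=> 1), (fun=> delta o y); split; first by move=> _; exists y.
  by rewrite big_ord1 scale1r.
elim: n => [|n [psi psi_span psiE]].
  exists 0; last by move=> f; rewrite /lift_sum big_ord0.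
  by exists 0%N, (fun=> 0), (fun=> 0); split; [case | rewrite big_ord0].
pose c := weight n / gap o x n.
exists (c *: delta o (x n) + (- c *: delta o (parent o x n) + psi)).
  by do 2!apply: linear_spanP => //.
move=> f.
have -> : (c *: delta o (x n) + (- c *: delta o (parent o x n) + psi)
    : dual (Lip0 o)) f = c * f (x n) + (- c * f (parent o x n) + psi f) by [].
by rewrite psiE /lift_sum big_ord_recr/= /c /coef; ring.
Qed.

(** The coefficients of a function of norm at most [1] are at most [1], so the
    partial sums converge in norm as fast as the sum of the absolute weights. *)
Lemma lift_in_span : lift_dual \in closed_span (range (delta o)).
Proof.
rewrite inE => B /nbhs_ballP[e /= e0 eB].
have e2 : 0 < e / 2 by rewrite divr_gt0.
pose s n := \sum_(k < n) `|weight k|.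
have s_nd : nondecreasing_seq s.
  by apply/nondecreasing_seqP => n; rewrite /s big_ord_recr/= lerDl.
have s_cvg : cvgn s.
  apply: nondecreasing_is_cvgn => //.
  by exists (8 * `|phi|) => _ [n _ <-]; exact: weight_summable.
have [N sN] : exists N, forall n, (N <= n)%N -> s n - s N <= e / 2.
  have /cvgrPdist_le/(_ _ e2)[N _ /(_ N (leqnn N))] := s_cvg => sN.
  exists N => n _; apply: le_trans sN; apply: le_trans (ler_norm _).
  by rewrite lerD2r; exact: nondecreasing_cvgn_le.
have [psi psi_span psiE] := lift_sum_span N.
exists psi; split => //; apply: eB; rewrite -ball_normE /=.
apply: (@le_lt_trans _ _ (e / 2)); last first.
  by rewrite ltr_pdivrMr// ltr_pMr// ltr1n.
suff tail_le (f : Lip0 o) : `|f| <= 1 ->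
    `|(lift_dual - psi : dual (Lip0 o)) f| <= e / 2.
  by apply: dual_norm_le => //; exact: ltW.
move=> f1; rewrite -[X in `|X|]/(lift_fun f - psi f) psiE.
have -> : lift_fun f - lift_sum f N =
    limn (fun n => lift_sum f n - lift_sum f N).
  apply/esym/cvg_lim => //; apply: cvgB; [exact: lift_cvg|exact: cvg_cst].
apply: lim_norm_le.
  by apply: is_cvgB; [exact: lift_cvg|exact: is_cvg_cst].
near=> n; have Nn : (N <= n)%N by near: n; exact: nbhs_infty_ge.
apply: le_trans (sN n Nn).
rewrite /s /lift_sum (sum_ord_tail (fun k => `|weight k|) Nn).
rewrite (sum_ord_tail (fun k => coef f k * weight k) Nn).
apply: le_trans (ler_norm_sum _ _ _) _; apply: ler_sum => k _.
rewrite normrM -[leRHS]mul1r ler_wpM2r//; exact: le_trans (coef_le _ _ _) f1.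
Unshelve. all: by end_near. Qed.

Lemma lift_restrict (f : S) : lift_dual (to_Lip0 f) = phi f.
Proof.
apply: cvg_lim => //; apply/cvgrPdist_le => e e0.
have e1 : 0 < e / (`|phi| + 1) by rewrite divr_gt0// ltr_wpDl.
have /cvgr0Pnorm_le/(_ _ e1) := psum_coef_cvg f; apply: filterS => n.
rewrite normr_id => fe; rewrite /lift_sum -phi_psum -linearB.
apply: le_trans (dual_le _ _) _.
move: fe; rewrite ler_pdivlMr ?ltr_wpDl//; apply: le_trans.
by rewrite mulrC ler_wpM2l// lerDl.
Qed.

Lemma free_restrict_onto : exists mu : lip_free o, free_restrict mu = phi.
Proof.
exists (exist (fun psi => psi \in closed_span (range (delta o)))
  lift_dual lift_in_span).
by apply: val_inj; apply/funext => f; exact: lift_restrict.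
Qed.

End surjectivity.

(** * S is isomorphic to c_0 *)

Section c0_isomorphism.
Context {R : realType} {M : metricType R} (o : M) (x : nat -> M).
Context (Mproper : proper_metric M) (Multra : ultrametric M).
Context (xinj : injective x) (xneqo : forall n, x n != o).
Context (xdense : forall y (e : R), 0 < e ->
  mdist o y < e \/ exists n, mdist (x n) y < e).
Local Notation S := (lip0_flat_space o).
Local Notation gap := (gap o x).
Local Notation coef := (coef o x).
Local Notation psum := (psum o x).
Local Notation synth := (synth o x).

Lemma gap_neq0 n : gap n != 0.
Proof.
suff xp : x n != parent o x n.
  rewrite gt_eqF//; apply: lt_le_trans (mdist_le_dyadic _ _).
  by rewrite mdist_gt0.
rewrite /parent; have [->//|[k kn ->]] := retr_in o x n (x n).
by apply/eqP => /xinj nk; rewrite nk ltnn in kn.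
Qed.

(** The spikes of index greater than [n] vanish at [x n]. *)
Lemma synth_at u n : synth u (x n) = psum u n (x n) + u n * gap n.
Proof.
apply: cvg_lim => //; apply: cvg_near_cst; near=> m.
have nm : (n < m)%N by near: m; exact: nbhs_infty_gt.
have -> : psum u n (x n) + u n * gap n = psum u n.+1 (x n).
  by rewrite /psum big_ord_recr/= spike_self.
rewrite /psum [RHS](big_ord_widen m (fun k => u k * spike o x k (x n)))//.
rewrite [RHS]big_mkcond.
apply: eq_bigr => k _; case: ltnP => //; rewrite ltnNge -ltnNge => nk.
by rewrite spike_later ?mulr0.
Unshelve. all: by end_near. Qed.

(** By [synth_at], the values at the points of the sequence determine the
    coefficients one after the other. *)
Lemma synth_injective u v : synth u =1 synth v -> u =1 v.
Proof.
move=> uv n; have [m] := ubnP n; elim: m n => // m IH n nm.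
have := uv (x n); rewrite !synth_at (_ : psum u n (x n) = psum v n (x n)).
  by move=> /addrI/(mulIf (gap_neq0 n)).
by apply: eq_bigr => k _; rewrite IH// (leq_trans (ltn_ord k)).
Qed.

Lemma c0_le (u : c0 R) n : `|u n| <= `|u|.
Proof. by apply: ub_le_sup; [exact: c0_bounded | exists n]. Qed.

Lemma c0_cvg (u : c0 R) : u @ \oo --> 0.
Proof. exact/asboolP/(valP u). Qed.

Definition c0_synth (u : c0 R) : S :=
  exist (fun f => f \in lip0_flat (o := o)) (synth_Lip0 o x Multra (c0_le u))
    (synth_flat _ _ Multra (c0_le u) (@c0_cvg u)).

Lemma coef_c0 (f : S) : coef (to_Lip0 f) \in c0_pred (R := R).
Proof. exact/asboolP/(coef_cvg0 Mproper xdense (valP f)). Qed.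

Definition c0_coef (f : S) : c0 R :=
  exist (fun u => u \in c0_pred (R := R)) (coef (to_Lip0 f)) (coef_c0 f).

Lemma c0_synth_linear : linear c0_synth.
Proof.
move=> a u v; apply: val_inj; apply: val_inj; apply/funext => y.
exact: (synth_linear o x Multra a y (c0_le u) (c0_le v)).
Qed.

Lemma c0_coef_linear : linear c0_coef.
Proof.
move=> a f g; apply: val_inj; apply/funext => n.
exact: (coef_linear x a (to_Lip0 f) (to_Lip0 g) n).
Qed.

HB.instance Definition _ :=
  GRing.isLinear.Build R (c0 R) S _ c0_synth c0_synth_linear.
HB.instance Definition _ :=
  GRing.isLinear.Build R S (c0 R) _ c0_coef c0_coef_linear.

Lemma c0_coefK : cancel c0_coef c0_synth.
Proof.
move=> f; apply: val_inj; apply: val_inj; apply/funext => y.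
exact: (synth_coef Multra xdense (to_Lip0 f)).
Qed.

(** [c0_coefK] at [c0_synth u] gives two sequences with the same image, and
    [c0_synth] is injective. *)
Lemma c0_synthK : cancel c0_synth c0_coef.
Proof.
move=> u; apply: val_inj; apply/funext; apply: synth_injective => y.
exact: (congr1 (fun f => to_Lip0 f y) (c0_coefK (c0_synth u))).
Qed.

Lemma c0_synth_le u : `|c0_synth u| <= 8 * `|u|.
Proof.
apply: (Lip0_norm_le (f := to_Lip0 (c0_synth u))); first by rewrite mulr_ge0.
by move=> y z; apply: (synth_lip _ _ Multra) => k; exact: c0_le.
Qed.

Lemma c0_coef_le f : `|c0_coef f| <= 1 * `|f|.
Proof.
rewrite mul1r; apply: sup_le_nneg => // _ [n _ <-].
exact: (coef_le x (to_Lip0 f)).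
Qed.

Lemma isomorphic_c0 : isomorphic (lip0_flat_space o) (c0 R).
Proof.
exists c0_coef, c0_synth; split.
- exact: c0_coefK.
- exact: c0_synthK.
- exact: bounded_continuous c0_coef_le.
- exact: bounded_continuous c0_synth_le.
Qed.

End c0_isomorphism.

(** * The duality and the isomorphism *)

Theorem theorem3p4 (R : realType) (M : metricType R) (o : M)
    (Mproper : proper_metric M) (Multra : ultrametric M) :
  isometrically_isomorphic (lip_free o) (dual (lip0_flat_space o)) /\
  (infinite_set [set: M] -> isomorphic (lip0_flat_space o) (c0 R)).
Proof.
split; last first.
  move=> /(proper_dense_injection o Mproper)[x [xinj xneqo xdense]].
  exact: (isomorphic_c0 (x := x)).
have [x xdense] := proper_dense_sequence o Mproper.
exists (@free_restrict R M o); split; last exact: free_restrict_isometry.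
rewrite -setTT_bijective; split => //.
  move=> mu nu _ _ munu; apply/eqP; rewrite -subr_eq0 -normr_eq0.
  by rewrite -(free_restrict_isometry Multra) linearB/= munu subrr normr0.
move=> phi _; have [mu <-] := free_restrict_onto (x := x) Mproper Multra
  (fun y e e0 => or_intror (xdense y e e0)) phi.
by exists mu.
Qed.
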